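(* There exists an absolute constant $c>0$ such that for every planar convex body $D\subset\mathbb{R}^2$ and every interior point $\boldsymbol{x}$ of $D$, $$U(\boldsymbol{x},D)\le c\,L(\boldsymbol{x},D),$$ where $U(\boldsymbol{x},D)$ and $L(\boldsymbol{x},D)$ are the quantities defined in the context.
   Context: A planar convex body is a convex compact subset of $\mathbb{R}^2$ with non-empty interior. $\|\cdot\|$ is the Euclidean norm on $\mathbb{R}^2$, $B=\{\boldsymbol{x}\in\mathbb{R}^2:\|\boldsymbol{x}\|\le 1\}$, $S=[0,1]^2$, $\tfrac12 S=[0,\tfrac12]^2$, and $(\boldsymbol{x})_i$ denotes the $i$-th coordinate of $\boldsymbol{x}$. $\mathbb{A}$ is the collection of all non-degenerate affine transforms of $\mathbb{R}^2$, i.e. maps $\mathcal{T}(\cdot)=\boldsymbol{z}+A\,\cdot$ with $\boldsymbol{z}\in\mathbb{R}^2$ and $A$ an invertible real $2\times 2$ matrix; $\det\mathcal{T}:=\det A$. For a planar convex body $D$ and $\boldsymbol{x}$ in the interior of $D$ define $$L(\boldsymbol{x},D):=\sup\{(1-\|\mathcal{L}^{-1}\boldsymbol{x}\|)^{1/2}\,|\det\mathcal{L}|:\ \mathcal{L}\in\mathbb{A},\ \boldsymbol{x}\in\mathcal{L}B\subset D\},$$ $$U(\boldsymbol{x},D):=\inf\{((\mathcal{U}^{-1}\boldsymbol{x})_1(\mathcal{U}^{-1}\boldsymbol{x})_2)^{1/2}\,|\det\mathcal{U}|:\ \mathcal{U}\in\mathbb{A},\ \boldsymbol{x}\in\mathcal{U}(\tfrac12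 S),\ D\subset\mathcal{U}S\}.$$ *)

(* Defs.v *)
From mathcomp Require Import all_boot all_order all_algebra.
From mathcomp Require Import all_classical all_reals all_analysis.

Set Implicit Arguments.
Unset Strict Implicit.
Unset Printing Implicit Defensive.

Import Order.TTheory GRing.Theory Num.Theory.
Import numFieldNormedType.Exports.

Local Open Scope classical_set_scope.
Local Open Scope ring_scope.

(* The library norm on matrices is the max norm; its topology is the usual
   one, but the Euclidean length has to be defined separately. *)
Definition enorm (R : realType) (x : 'cV[R]_2) : R :=
  Num.sqrt (\sum_i x i 0 ^+ 2).

Definition unit_disk (R : realType) : set 'cV[R]_2 := [set x | enorm x <= 1].

Definition unit_square (R : realType) : set 'cV[R]_2 :=
  [set x | forall i, 0 <= x i 0 <= 1].

Definition half_square (R : realType) : set 'cV[R]_2 :=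
  [set x | forall i, 0 <= x i 0 <= 2^-1].

Arguments unit_disk R : clear implicits.
Arguments unit_square R : clear implicits.
Arguments half_square R : clear implicits.

Definition planar_convex_body (R : realType) (D : set 'cV[R]_2) : Prop :=
  [/\ convex_set D, compact D & D° !=set0].

Record affine (R : realType) := Affine {
  aff_shift : 'cV[R]_2;
  aff_mx : 'M[R]_2;
  aff_mx_unit : aff_mx \in unitmx }.

Definition aff_fun (R : realType) (T : affine R) (y : 'cV[R]_2) : 'cV[R]_2 :=
  aff_shift T + aff_mx T *m y.

Coercion aff_fun : affine >-> Funclass.

Definition aff_inv (R : realType) (T : affine R) (x : 'cV[R]_2) : 'cV[R]_2 :=
  invmx (aff_mx T) *m (x - aff_shift T).

Definition aff_det (R : realType) (T : affine R) : R := \det (aff_mx T).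

Lemma aff_funK (R : realType) (T : affine R) : cancel T (aff_inv T).
Proof.
by move=> y; rewrite /aff_inv /aff_fun addrC addKr mulKmx ?aff_mx_unit.
Qed.

Lemma aff_invK (R : realType) (T : affine R) : cancel (aff_inv T) T.
Proof.
by move=> x; rewrite /aff_inv /aff_fun mulKVmx ?aff_mx_unit// addrC subrK.
Qed.

(* The supremum and infimum are taken in the extended reals, so that they are
   meaningful without a prior proof of boundedness. Num.sqrt renders the
   exponent 1/2: membership of x in the image of the disk (resp. of the half
   square) makes its argument nonnegative. *)
Definition L_sup (R : realType) (x : 'cV[R]_2) (D : set 'cV[R]_2) : \bar R :=
  ereal_sup [set (Num.sqrt (1 - enorm (aff_inv T x)) * `|aff_det T|)%:E |
    T in [set T : affine R |
           (T @` unit_disk R) x /\ T @` unit_disk R `<=` D]].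

Definition U_inf (R : realType) (x : 'cV[R]_2) (D : set 'cV[R]_2) : \bar R :=
  ereal_inf [set (Num.sqrt (aff_inv T x 0 0 * aff_inv T x 1 0)
                    * `|aff_det T|)%:E |
    T in [set T : affine R |
           (T @` half_square R) x /\ D `<=` T @` unit_square R]].

(* Main.v *)
Require Import Defs.
From mathcomp Require Import all_boot all_order all_algebra.
From mathcomp Require Import all_classical all_reals all_analysis.
From mathcomp Require Import ring lra.

Set Implicit Arguments.
Unset Strict Implicit.
Unset Printing Implicit Defensive.

Import Order.TTheory GRing.Theory Num.Theory.
Import numFieldNormedType.Exports.

Local Open Scope classical_set_scope.
Local Open Scope ring_scope.

(* For a covector v let d(v) be the height of the supporting line of D with
   outer normal v above x, and P(v) = d(v) d(-v). A parallelogram circumscribed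
   about D with sides normal to v and w gives
   U <= 2 (P(v) P(w))^(1/2) / |v ^ w|, so it suffices to find, for m > 0 with
   m^2 (v ^ w)^2 <= P(v) P(w) for all v and w, an ellipse in D of value at
   least m / 24. The ellipse centred at x + c whose support function relative
   to x is v.c + (Q(v) + (v.c)^2)^(1/2) contains x when the quadratic form Q is
   positive definite, and its value is at least (det Q / 2)^(1/2). It lies in D
   as soon as Q(v) <= d(v) (d(v) - 2 v.c), the second factor being the height
   of the supporting line above x + 2 c. If x + 2 c is deep inside D the
   right-hand side is at least P(v) / 6. Finally, if v0 minimizes P(v) / (v.c)^2
   up to a factor 2, the form
     Q(v) = (m^2 (v ^ v0)^2 / P(v0) + P(v0) (v.c)^2 / (2 (v0.c)^2)) / 12
   satisfies Q <= P / 6 and det Q = m^2 / 288. *)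

(** * Coordinates and determinants in the plane *)

Lemma sum_ord2 (V : nmodType) (F : 'I_2 -> V) : \sum_i F i = F 0 + F 1.
Proof. by rewrite big_ord_recl big_ord1; congr (_ + F _); exact: val_inj. Qed.

Lemma ord2_ind (P : 'I_2 -> Prop) : P 0 -> P 1 -> forall i, P i.
Proof.
by move=> P0 P1 [[|[|//]] h]; [move: P0|move: P1]; congr P; exact: val_inj.
Qed.

Lemma eq_ler (R : numDomainType) (a b : R) : a = b -> a <= b.
Proof. by move=> ->. Qed.

Lemma cV2P (R : Type) (u v : 'cV[R]_2) :
  u 0 0 = v 0 0 -> u 1 0 = v 1 0 -> u = v.
Proof. by move=> h0 h1; apply/colP; exact: ord2_ind. Qed.

Lemma det_mx22 (R : comPzRingType) (A : 'M[R]_2) :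
  \det A = A 0 0 * A 1 1 - A 0 1 * A 1 0.
Proof.
rewrite (expand_det_row _ 0) sum_ord2 /cofactor !det_mx11 !mxE /=.
rewrite expr0 expr1 mul1r mulN1r mulrN.
by congr (_ * A _ _ - _ * A _ _); exact: val_inj.
Qed.

Lemma mulmx2E (R : pzRingType) (A : 'M[R]_2) (y : 'cV[R]_2) i :
  (A *m y) i 0 = A i 0 * y 0 0 + A i 1 * y 1 0.
Proof. by rewrite mxE sum_ord2. Qed.

Lemma enorm2E (R : realType) (y : 'cV[R]_2) :
  enorm y = Num.sqrt (y 0 0 ^+ 2 + y 1 0 ^+ 2).
Proof. by rewrite /enorm sum_ord2. Qed.

Definition col2 (R : pzRingType) (a b : R) : 'cV[R]_2 := \col_i [:: a; b]`_i.

Definition mx2 (R : pzRingType) (a b c d : R) : 'M[R]_2 :=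
  \matrix_(i, j) (nth [::] [:: [:: a; b]; [:: c; d]] i)`_j.

(** * Dot and wedge products, and heights of supporting lines *)

Definition dotv (R : realType) (v y : 'cV[R]_2) : R :=
  v 0 0 * y 0 0 + v 1 0 * y 1 0.

Definition wedge (R : realType) (v w : 'cV[R]_2) : R :=
  v 0 0 * w 1 0 - v 1 0 * w 0 0.

(* [gap D x] and [gap2 D x] are the functions d and P above; the supremum is the
   junk value [0] when [D] is empty or unbounded in the direction [v]. *)
Definition gap (R : realType) (D : set 'cV[R]_2) (x v : 'cV[R]_2) : R :=
  sup [set dotv v (y - x) | y in D].

Definition gap2 (R : realType) (D : set 'cV[R]_2) (x v : 'cV[R]_2) : R :=
  gap D x v * gap D x (- v).

Lemma gap2N (R : realType) (D : set 'cV[R]_2) x v :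
  gap2 D x (- v) = gap2 D x v.
Proof. by rewrite /gap2 opprK mulrC. Qed.

Lemma dotNv (R : realType) (v y : 'cV[R]_2) : dotv (- v) y = - dotv v y.
Proof. by rewrite /dotv !mxE; ring. Qed.

Lemma wedgeNv (R : realType) (v y : 'cV[R]_2) : wedge (- v) y = - wedge v y.
Proof. by rewrite /wedge !mxE; ring. Qed.

Lemma wedgevN (R : realType) (v y : 'cV[R]_2) : wedge v (- y) = - wedge v y.
Proof. by rewrite /wedge !mxE; ring. Qed.

Lemma dotv_gt0 (R : realType) (v : 'cV[R]_2) : v != 0 -> 0 < dotv v v.
Proof.
move=> v0; rewrite /dotv -!expr2 lt_neqAle addr_ge0 ?sqr_ge0// andbT eq_sym.
rewrite paddr_eq0 ?sqr_ge0// !sqrf_eq0.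
apply: contra v0 => /andP[/eqP h0 /eqP h1].
by apply/eqP; apply: cV2P; rewrite mxE.
Qed.

(** * Continuity of the functions to be optimized over [D] *)

Lemma coordB_continuous (R : realType) (x : 'cV[R]_2) i :
  continuous (fun y : 'cV[R]_2 => y i 0 - x i 0).
Proof.
move=> y.
by apply: continuousB; [exact: coord_continuous|exact: cst_continuous].
Qed.

Lemma dotv_continuous (R : realType) (v x : 'cV[R]_2) :
  continuous (fun y : 'cV[R]_2 => dotv v (y - x)).
Proof.
rewrite (_ : (fun y : 'cV[R]_2 => dotv v (y - x)) =
  fun y : 'cV[R]_2 => v 0 0 * (y 0 0 - x 0 0) + v 1 0 * (y 1 0 - x 1 0));
  last first.
  by apply/funext => y; rewrite /dotv !mxE.
move=> y; apply: (@cvgD _ _ _ (nbhs y)); apply: (@cvgM _ _ (nbhs y)).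
all: exact: cvg_cst || exact: coordB_continuous.
Qed.

Lemma dist2_continuous (R : realType) (x : 'cV[R]_2) :
  continuous (fun y : 'cV[R]_2 => dotv (y - x) (y - x)).
Proof.
rewrite (_ : (fun y : 'cV[R]_2 => dotv (y - x) (y - x)) =
  fun y : 'cV[R]_2 => (y 0 0 - x 0 0) * (y 0 0 - x 0 0) +
                      (y 1 0 - x 1 0) * (y 1 0 - x 1 0)); last first.
  by apply/funext => y; rewrite /dotv !mxE.
by move=> y; apply: (@cvgD _ _ _ (nbhs y)); apply: (@cvgM _ _ (nbhs y));
  exact: coordB_continuous.
Qed.

Lemma wedge_continuous (R : realType) (x : 'cV[R]_2) :
  continuous (fun bc : 'cV[R]_2 * 'cV[R]_2 => wedge (bc.1 - x) (bc.2 - x)).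
Proof.
rewrite (_ : (fun bc : 'cV[R]_2 * 'cV[R]_2 => wedge (bc.1 - x) (bc.2 - x)) =
  fun bc : 'cV[R]_2 * 'cV[R]_2 =>
  (bc.1 0 0 - x 0 0) * (bc.2 1 0 - x 1 0) -
  (bc.1 1 0 - x 1 0) * (bc.2 0 0 - x 0 0)); last first.
  by apply/funext => bc; rewrite /wedge !mxE.
have cont1 i : continuous (fun bc : 'cV[R]_2 * 'cV[R]_2 => bc.1 i 0 - x i 0).
  move=> bc.
  by apply: (@continuous_comp _ _ _ fst (fun y : 'cV[R]_2 => y i 0 - x i 0));
    [exact: cvg_fst|exact: coordB_continuous].
have cont2 i : continuous (fun bc : 'cV[R]_2 * 'cV[R]_2 => bc.2 i 0 - x i 0).
  move=> bc.
  by apply: (@continuous_comp _ _ _ snd (fun y : 'cV[R]_2 => y i 0 - x i 0));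
    [exact: cvg_snd|exact: coordB_continuous].
move=> bc; apply: (@cvgB _ _ _ (nbhs bc)); apply: (@cvgM _ _ (nbhs bc)).
all: exact: cont1 || exact: cont2.
Qed.

(** * Bounds on support heights *)

Lemma le_gap (R : realType) (D : set 'cV[R]_2) x v y :
  compact D -> D y -> dotv v (y - x) <= gap D x v.
Proof.
move=> cD Dy; apply: ub_le_sup; last by exists y.
have [] // : has_sup [set dotv v (y - x) | y in D].
apply: compact_has_sup; first by exists (dotv v (y - x)), y.
apply: continuous_compact => //; apply: continuous_subspaceT.
exact: dotv_continuous.
Qed.

Arguments le_gap {R D} x v {y}.

Lemma gap_le (R : realType) (D : set 'cV[R]_2) x v t :
  D !=set0 -> (forall y, D y -> dotv v (y - x) <= t) -> gap D x v <= t.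
Proof.
move=> [y Dy] ub; apply: ge_sup; first by exists (dotv v (y - x)), y.
by move=> _ [z Dz <-]; exact: ub.
Qed.

Lemma interior_box (R : realType) (D : set 'cV[R]_2) x : D° x ->
  exists2 e : R, 0 < e &
    forall a b, `|a| <= e -> `|b| <= e -> D (x + col2 a b).
Proof.
move=> /nbhs_ballP[e /= e0 eD]; exists (e / 2); first by rewrite divr_gt0.
move=> a b ha hb; apply: eD; split => //= i j.
rewrite (ord1 j) -ball_normE /= !mxE opprD addrA subrr sub0r normrN.
move: i; apply: ord2_ind => /=; lra.
Qed.

(** A square of half-side [e] about [x] lies in [D]; the height is tested at [x] moved by [e] along
    axis [i], towards the sign of [v i 0]. This makes [gap] positive for nonzero [v], with a uniform
    constant. *)
Lemma gap_ge_coord (R : realType) (D : set 'cV[R]_2) x :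
  compact D -> D° x ->
  exists2 e : R, 0 < e & forall (v : 'cV[R]_2) i, e * `|v i 0| <= gap D x v.
Proof.
move=> cD /interior_box[e e0 eD]; exists e => // v.
have e_sg (s : R) : `|e * Num.sg s| <= e.
  by rewrite normrM normr_sg gtr0_norm// ler_piMr ?(ltW e0)// lern1 leq_b1.
have e_0 : `|0 : R| <= e by rewrite normr0 ltW.
apply: ord2_ind.
- apply: (le_trans _ (le_gap x v cD (eD _ _ (e_sg (v 0 0)) e_0))).
  by rewrite /dotv !mxE /= normrEsg; apply: eq_ler; ring.
- apply: (le_trans _ (le_gap x v cD (eD _ _ e_0 (e_sg (v 1 0))))).
  by rewrite /dotv !mxE /= normrEsg; apply: eq_ler; ring.
Qed.

Lemma gap_ge0 (R : realType) (D : set 'cV[R]_2) x v :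
  compact D -> D x -> 0 <= gap D x v.
Proof.
move=> cD Dx; apply: (le_trans _ (le_gap x v cD Dx)).
by rewrite /dotv !mxE; apply: eq_ler; ring.
Qed.

Lemma gap2_ge0 (R : realType) (D : set 'cV[R]_2) x v :
  compact D -> D x -> 0 <= gap2 D x v.
Proof. by move=> cD Dx; rewrite mulr_ge0// gap_ge0. Qed.

Lemma gap2_ge_coord (R : realType) (D : set 'cV[R]_2) x :
  compact D -> D° x ->
  exists2 e : R, 0 < e & forall (v : 'cV[R]_2) i, e * v i 0 ^+ 2 <= gap2 D x v.
Proof.
move=> cD Dx; have [e e0 eP] := gap_ge_coord cD Dx.
exists (e ^+ 2) => [|v i]; first by rewrite exprn_gt0.
have h1 := eP v i; have h2 := eP (- v) i.
rewrite mxE normrN in h2.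
rewrite -[v i 0 ^+ 2]real_normK ?num_real// -exprMn expr2.
by apply: ler_pM => //; rewrite mulr_ge0// ltW.
Qed.

(** * Convexity and separation *)

Lemma convex_comb (R : realType) (D : set 'cV[R]_2) a b t :
  convex_set D -> D a -> D b -> 0 <= t -> t <= 1 ->
  D (t *: a + (1 - t) *: b).
Proof.
move=> cD Da Db t0 t1.
by have := cD a b (Itv01 t0 t1); rewrite !inE; exact.
Qed.

(** The normal is [y - w], where [w] is a point of [D] nearest to [y]. *)
Lemma separation (R : realType) (D : set 'cV[R]_2) x y :
  convex_set D -> compact D -> D !=set0 -> ~ D y ->
  exists v, gap D x v < dotv v (y - x).
Proof.
move=> cvD cD D0 Dy.
have [] := @compact_EVT_min _ _
  (fun t : 'cV[R]_2 => dotv (t - y) (t - y)) _ D0 cD.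
  by apply: continuous_subspaceT; exact: dist2_continuous.
move=> w Dw wmin.
rewrite inE in Dw; exists (y - w).
have yw : 0 < dotv (y - w) (y - w).
  by apply: dotv_gt0; rewrite subr_eq0; apply/eqP => yw; apply: Dy; rewrite yw.
apply: (@le_lt_trans _ _ (dotv (y - w) (w - x))); last first.
  rewrite -subr_gt0 (_ : _ - _ = dotv (y - w) (y - w))//.
  by rewrite /dotv !mxE; ring.
apply: gap_le => // z Dz.
set S := dotv (y - w) (z - w); set N := dotv (z - w) (z - w).
have N0 : 0 <= N by rewrite /N /dotv -!expr2 addr_ge0 ?sqr_ge0.
suff S0 : S <= 0.
  rewrite -subr_le0 (_ : _ - _ = S)//.
  by rewrite /S /dotv !mxE; ring.
rewrite leNgt; apply/negP => S0.
have SN : 0 < S + N by lra.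
(* Moving from [w] towards [z] by [t] changes the squared distance to [y] by [t * (t * N - 2 * S)].
   This [t] is at most 1 and has [t * N <= S], so the change would be negative. *)
pose t := S / (S + N).
have t0 : 0 < t by rewrite divr_gt0.
have t1 : t <= 1 by rewrite ler_pdivrMr// mul1r; lra.
have := wmin (t *: z + (1 - t) *: w).
rewrite inE => /(_ (convex_comb cvD Dz Dw (ltW t0) t1)).
rewrite -subr_ge0 (_ : _ - _ = t * (t * N - 2 * S)); last first.
  by rewrite /N /S /dotv !mxE; ring.
rewrite pmulr_rge0// subr_ge0 => h.
have : t * N <= S.
  by rewrite /t -mulrA -[leRHS]mulr1 ler_pM2l// mulrC ler_pdivrMr// mul1r; lra.
lra.
Qed.

(** * Centre of the ellipse and choice of its quadratic form *)

(* If the triangle [x], [x + p], [x + q] inscribed in [D] has maximal area, then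
   [D] lies in the parallelogram [x + [-1, 1] p + [-1, 1] q], so that the
   centroid [x + 2 c] of the triangle is deep inside [D]. *)
Lemma deep_point (R : realType) (D : set 'cV[R]_2) x :
  compact D -> D° x ->
  exists2 c : 'cV[R]_2, c != 0 &
    forall v, gap D x (- v) <= 6 * (gap D x v - 2 * dotv v c).
Proof.
move=> cD Dx; have Dx' : D x by exact: interior_subset.
have [e e0 eD] := interior_box Dx.
have [] := @compact_EVT_max _ _
  (fun t : 'cV[R]_2 * 'cV[R]_2 => wedge (t.1 - x) (t.2 - x)) (D `*` D).
- by exists (x, x).
- exact: compact_setX.
- by apply: continuous_subspaceT; exact: wedge_continuous.
move=> [b c]; rewrite inE => -[/= Db Dc] bcmax.
have {}bcmax b' c' : D b' -> D c' ->
    wedge (b' - x) (c' - x) <= wedge (b - x) (c - x).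
  by move=> Db' Dc'; have := bcmax (b', c'); rewrite inE; apply.
set p := b - x in bcmax *; set q := c - x in bcmax *.
have W0 : 0 < wedge p q.
  (* A right triangle with legs [e] fits in [D], so the maximal area is positive. *)
  have := bcmax (x + col2 e 0) (x + col2 0 e).
  rewrite (_ : wedge _ _ = e * e); last by rewrite /wedge !mxE /=; ring.
  have ee : `|e| <= e by rewrite gtr0_norm.
  have e00 : `|0 : R| <= e by rewrite normr0 ltW.
  move=> /(_ (eD _ _ ee e00) (eD _ _ e00 ee)); apply: lt_le_trans.
  by rewrite mulr_gt0.
exists (6^-1 *: (p + q)) => [|v].
  apply/eqP => pq0; move: W0; rewrite (_ : p = - q) ?wedgeNv.
    by rewrite /wedge [X in - X](_ : _ = 0) ?oppr0 ?ltxx//; ring.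
  apply/eqP; rewrite -addr_eq0; apply/eqP.
  by move/eqP: pq0; rewrite scaler_eq0 invr_eq0 pnatr_eq0 => /eqP.
have gp : dotv v p <= gap D x v by exact: le_gap.
have gq : dotv v q <= gap D x v by exact: le_gap.
have g0 : 0 <= gap D x v by exact: gap_ge0.
have -> : dotv v (6^-1 *: (p + q)) = (dotv v p + dotv v q) / 6.
  by rewrite /dotv !mxE; ring.
(* Both dot products [s] are at most [d := gap D x v], and [0 <= d], so [|s| + 2 s <= 3 d]; adding
   the two bounds gives the factor 6. *)
have : gap D x (- v) <= `|dotv v p| + `|dotv v q|; last first.
  case: (ger0P (dotv v p)) => hp; case: (ger0P (dotv v q)) => hq; lra.
apply: gap_le => [|y Dy]; first by exists x.
(* By Cramer's rule [y - x] has coordinates [l / wedge p q] and [k / wedge p q] in the basis [p],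
   [q]; maximality bounds both by 1 in absolute value. *)
set l := wedge (y - x) q; set k := wedge p (y - x).
have abs_wedge (s : R) :
    s <= wedge p q -> - s <= wedge p q -> `|s| <= wedge p q.
  by move=> ? ?; rewrite ler_norml; lra.
have hl : `|l| <= wedge p q.
  apply: abs_wedge; first exact: bcmax.
  by rewrite (_ : - l = wedge q (y - x)) ?bcmax// /l /wedge; ring.
have hk : `|k| <= wedge p q.
  apply: abs_wedge; first exact: bcmax.
  by rewrite (_ : - k = wedge (y - x) p) ?bcmax// /k /wedge; ring.
have E : wedge p q * dotv (- v) (y - x) = - (l * dotv v p) - k * dotv v q.
  by rewrite /l /k /wedge /dotv !mxE; ring.
rewrite -(ler_pM2l W0) E [leRHS]mulrDr.
by rewrite lerD// (le_trans (ler_norm _))// normrN normrM ler_wpM2r.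
Qed.

(** The quotient [P(v) / (v.c)^2] has a positive infimum, since [P(v)] dominates a multiple of
    [|v|^2] and Cauchy-Schwarz bounds [(v.c)^2]. Hence some [v0] comes within a factor 2 of it. *)
Lemma near_minimizer (R : realType) (D : set 'cV[R]_2) x c :
  compact D -> D° x -> c != 0 ->
  exists2 v0, dotv v0 c != 0 &
    forall v, gap2 D x v0 * dotv v c ^+ 2 <= 2 * gap2 D x v * dotv v0 c ^+ 2.
Proof.
move=> cD Dx c0; have [e e0 eP] := gap2_ge_coord cD Dx.
have Dx' : D x by exact: interior_subset.
pose Q v := gap2 D x v / dotv v c ^+ 2.
pose S := [set Q v | v in [set v | dotv v c != 0]].
have cc0 := dotv_gt0 c0.
have S0 : S !=set0 by exists (Q c), c => //=; rewrite gt_eqF.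
have lbS : lbound S (e / (2 * dotv c c)).
  move=> _ [v /= vc <-]; rewrite ler_pdivlMr ?exprn_even_gt0//.
  rewrite mulrAC ler_pdivrMr ?mulr_gt0//.
  have h0 := eP v 0; have h1 := eP v 1.
  have : dotv v c ^+ 2 <= dotv v v * dotv c c.
    rewrite -subr_ge0 (_ : _ - _ = wedge v c ^+ 2) ?sqr_ge0//.
    by rewrite /wedge /dotv; ring.
  rewrite -(ler_pM2l e0) => /le_trans; apply.
  have evv : e * dotv v v <= gap2 D x v * 2 by rewrite /dotv -!expr2; lra.
  by rewrite !mulrA; exact: ler_wpM2r (ltW cc0) _ _ evv.
have infS : has_inf S by split => //; exists (e / (2 * dotv c c)).
have inf0 : 0 < inf S.
  by apply: lt_le_trans (lb_le_inf S0 lbS); rewrite divr_gt0// mulr_gt0.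
(* The tolerance is [inf S] itself, whence [Q v0 < 2 * inf S]. *)
have [_ [v0 /= v0c <-] v0inf] := inf_adherent inf0 infS.
exists v0 => // v; have [vc|vc] := eqVneq (dotv v c) 0.
  by rewrite vc expr0n /= mulr0 mulr_ge0 ?sqr_ge0// mulr_ge0// gap2_ge0.
have : Q v0 <= 2 * Q v.
  have : inf S <= Q v by apply: (ge_inf infS.2); exists v.
  lra.
rewrite /Q ler_pdivrMr ?exprn_even_gt0//.
have -> : 2 * (gap2 D x v / dotv v c ^+ 2) * dotv v0 c ^+ 2 =
    2 * gap2 D x v * dotv v0 c ^+ 2 / dotv v c ^+ 2 by ring.
by rewrite ler_pdivlMr ?exprn_even_gt0.
Qed.

(** * Circumscribed parallelograms *)

Lemma U_inf_le_gap (R : realType) (D : set 'cV[R]_2) x v w :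
  compact D -> D° x -> wedge v w != 0 ->
  gap D x v <= gap D x (- v) -> gap D x w <= gap D x (- w) ->
  (U_inf x D <= (2 * Num.sqrt (gap2 D x v * gap2 D x w) / `|wedge v w|)%:E)%E.
Proof.
move=> cD Dx W0 hv hw; have Dx' : D x by exact: interior_subset.
have [e e0 eP] := gap_ge_coord cD Dx.
have gap_gt0 (u : 'cV[R]_2) : (u 0 0 != 0) || (u 1 0 != 0) -> 0 < gap D x u.
  by case/orP => ui; [apply: lt_le_trans (eP u 0)|apply: lt_le_trans (eP u 1)];
    rewrite mulr_gt0 ?normr_gt0.
have a0 : 0 < gap D x v.
  apply: gap_gt0; apply: contraNT W0; rewrite negb_or !negbK.
  by move=> /andP[/eqP h0 /eqP h1]; rewrite /wedge h0 h1 !mul0r subr0.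
have b0 : 0 < gap D x w.
  apply: gap_gt0; apply: contraNT W0; rewrite negb_or !negbK.
  by move=> /andP[/eqP h0 /eqP h1]; rewrite /wedge h0 h1 !mulr0 subr0.
rewrite /gap2.
have av y : D y -> dotv v (y - x) <= gap D x v by exact: le_gap.
have av' y : D y -> - dotv v (y - x) <= gap D x (- v).
  by move=> Dy; rewrite -dotNv; exact: le_gap.
have bw y : D y -> dotv w (y - x) <= gap D x w by exact: le_gap.
have bw' y : D y -> - dotv w (y - x) <= gap D x (- w).
  by move=> Dy; rewrite -dotNv; exact: le_gap.
move: (gap D x v) (gap D x (- v)) (gap D x w) (gap D x (- w))
  hv hw a0 b0 av av' bw bw' => a a' b b' hv hw a0 b0 av av' bw bw'.
have sa0 : 0 < a + a' by lra.
have sb0 : 0 < b + b' by lra.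
(* The inverse map is [y |-> V (y - x) + u]. It measures relative distances from the supporting
   lines normal to [v] and [w]. These are the lines nearer to [x], so [x] falls in the half
   square. *)
pose V := mx2 (- v 0 0 / (a + a')) (- v 1 0 / (a + a'))
              (- w 0 0 / (b + b')) (- w 1 0 / (b + b')).
pose u := col2 (a / (a + a')) (b / (b + b')).
have detV : \det V = wedge v w / ((a + a') * (b + b')).
  by rewrite det_mx22 !mxE /= /wedge; field; rewrite !gt_eqF.
have Vu : V \in unitmx.
  by rewrite unitmxE detV unitfE mulf_neq0// invr_neq0// gt_eqF// mulr_gt0.
pose T := @Affine R (x - invmx V *m u) (invmx V) (etrans (unitmx_inv V) Vu).
have Tinv y : aff_inv T y = V *m (y - x) + u.
  by rewrite /aff_inv /= invmxK opprB addrCA mulmxDr mulKVmx// [RHS]addrC.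
have Tinv0 y : aff_inv T y 0 0 = (a - dotv v (y - x)) / (a + a').
  by rewrite Tinv mxE mulmx2E /dotv !mxE /=; field; rewrite gt_eqF.
have Tinv1 y : aff_inv T y 1 0 = (b - dotv w (y - x)) / (b + b').
  by rewrite Tinv mxE mulmx2E /dotv !mxE /=; field; rewrite gt_eqF.
have dxx z : dotv z (x - x) = 0 by rewrite subrr /dotv !mxE !mulr0 addr0.
have W0' : 0 < `|wedge v w| by rewrite normr_gt0.
apply: (@le_trans _ _
  (Num.sqrt (aff_inv T x 0 0 * aff_inv T x 1 0) * `|aff_det T|)%:E).
  apply: ereal_inf_lbound; exists T => //; split.
    exists (aff_inv T x); last exact: aff_invK.
    apply: ord2_ind; rewrite ?Tinv0 ?Tinv1 dxx subr0.
      by rewrite divr_ge0 ?(ltW a0) ?(ltW sa0)//= ler_pdivrMr//; lra.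
    by rewrite divr_ge0 ?(ltW b0) ?(ltW sb0)//= ler_pdivrMr//; lra.
  move=> y Dy; exists (aff_inv T y); last exact: aff_invK.
  have := (av y Dy, av' y Dy, bw y Dy, bw' y Dy) => -[[[h1 h2] h3] h4].
  apply: ord2_ind; rewrite ?Tinv0 ?Tinv1.
    by rewrite divr_ge0 ?(ltW sa0)//= ?ler_pdivrMr//; lra.
  by rewrite divr_ge0 ?(ltW sb0)//= ?ler_pdivrMr//; lra.
rewrite lee_fin Tinv0 Tinv1 !dxx !subr0 /aff_det /= det_inv detV.
rewrite invf_div normrM normfV [leLHS]mulrA ler_wpM2r ?invr_ge0//.
have ss0 : 0 < (a + a') * (b + b') by exact: mulr_gt0.
have -> : `|(a + a') * (b + b')| = Num.sqrt (((a + a') * (b + b')) ^+ 2).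
  by rewrite sqrtr_sqr.
have -> : 2 = Num.sqrt (2 ^+ 2) :> R by rewrite sqrtr_sqr ger0_norm.
have abs0 : 0 <= a / (a + a') * (b / (b + b')).
  by rewrite mulr_ge0// divr_ge0// ltW.
rewrite -sqrtrM// -sqrtrM ?sqr_ge0//.
apply: ler_wsqrtr.
(* The constant 2 of the bound comes from [a + a' <= 2 * a'] and [b + b' <= 2 * b']. *)
rewrite (_ : _ * (_ * _) ^+ 2 = (a * (a + a')) * (b * (b + b'))); last first.
  by field; rewrite !gt_eqF.
rewrite (_ : 2 ^+ 2 * _ = (a * (2 * a')) * (b * (2 * b'))); last by ring.
by apply: ler_pM;
  rewrite ?mulr_ge0 ?ler_wpM2l ?(ltW a0) ?(ltW b0) ?(ltW sa0) ?(ltW sb0)//; lra.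
Qed.

(** Replacing [v] or [w] by its opposite changes neither [gap2] nor the absolute wedge, so the
    nearer supporting lines may be chosen. *)
Lemma U_inf_le (R : realType) (D : set 'cV[R]_2) x v w :
  compact D -> D° x -> wedge v w != 0 ->
  (U_inf x D <= (2 * Num.sqrt (gap2 D x v * gap2 D x w) / `|wedge v w|)%:E)%E.
Proof.
move=> cD Dx W0.
wlog hv : v W0 / gap D x v <= gap D x (- v).
  move=> H; case: (leP (gap D x v) (gap D x (- v))) => [|/ltW]; first exact: H.
  by move: (H (- v)); rewrite gap2N wedgeNv normrN oppr_eq0 opprK; exact.
wlog hw : w W0 / gap D x w <= gap D x (- w).
  move=> H; case: (leP (gap D x w) (gap D x (- w))) => [|/ltW]; first exact: H.
  by move: (H (- w)); rewrite gap2N wedgevN normrN oppr_eq0 opprK; exact.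
exact: U_inf_le_gap.
Qed.

(** * The inscribed ellipse *)

Lemma L_sup_ge (R : realType) (D : set 'cV[R]_2) x m :
  convex_set D -> compact D -> D° x -> 0 < m ->
  (forall v w, m ^+ 2 * wedge v w ^+ 2 <= gap2 D x v * gap2 D x w) ->
  ((m / 24)%:E <= L_sup x D)%E.
Proof.
move=> cvD cD Dx m0 mP; have Dx' : D x by exact: interior_subset.
have [c c0 cP] := deep_point cD Dx.
have [v0 v0c v0P] := near_minimizer cD Dx c0.
have P0 : 0 < gap2 D x v0.
  have [e e0 eP] := gap2_ge_coord cD Dx.
  have [h|h] := eqVneq (v0 0 0) 0; last first.
    by apply: lt_le_trans (eP v0 0); rewrite mulr_gt0// exprn_even_gt0.
  apply: lt_le_trans (eP v0 1); rewrite mulr_gt0// exprn_even_gt0//=.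
  by apply: contra v0c => /eqP h1; rewrite /dotv h h1 !mul0r addr0.
set P := gap2 D x v0 in v0P P0; set s0 := dotv v0 c in v0c v0P.
have s02 : 0 < s0 ^+ 2 by rewrite exprn_even_gt0.
(* [sg] and [k ^+ 2] are the coefficients of [(v.c)^2] and [(v ^ v0)^2] in [Q]; [g ^+ 2] adds the 1
   from the term [(v.c)^2] under the root of the support function. *)
pose sg := P / (24 * s0 ^+ 2).
have sg0 : 0 < sg by rewrite divr_gt0// mulr_gt0.
pose g := Num.sqrt (1 + sg).
have g2 : g ^+ 2 = 1 + sg by rewrite sqr_sqrtr// addr_ge0// ltW.
have g0 : 0 < g by rewrite sqrtr_gt0 addr_gt0.
pose k := m / Num.sqrt (12 * P).
have sP0 : 0 < Num.sqrt (12 * P) by rewrite sqrtr_gt0 mulr_gt0.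
have k2 : k ^+ 2 = m ^+ 2 / (12 * P).
  by rewrite expr_div_n sqr_sqrtr// mulr_ge0// ltW.
have k0 : 0 < k by rewrite divr_gt0.
(* Paired with [v], the columns give [k (v ^ v0)] and [g (v.c)], whose squares sum to
   [Q(v) + (v.c)^2]. *)
pose A := mx2 (k * v0 1 0) (g * c 0 0) (- (k * v0 0 0)) (g * c 1 0).
have detA : \det A = k * g * s0.
  by rewrite det_mx22 !mxE /= /s0 /dotv; ring.
have Au : A \in unitmx.
  rewrite unitmxE detA unitfE.
  exact: mulf_neq0 (mulf_neq0 (lt0r_neq0 k0) (lt0r_neq0 g0)) v0c.
pose T := @Affine R (x + c) A Au.
have TE u i : T u i 0 = x i 0 + c i 0 + (A i 0 * u 0 0 + A i 1 * u 1 0).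
  by rewrite mxE mulmx2E [X in X + _]mxE.
have Tx : T (col2 0 (- g^-1)) = x.
  by apply: cV2P; rewrite TE !mxE /=; field; rewrite gt_eqF.
have Tinvx : aff_inv T x = col2 0 (- g^-1) by rewrite -{1}Tx aff_funK.
have g1 : 1 <= g by rewrite -(ler_pXn2r (n := 2)) ?nnegrE ?ltW// g2 expr1n; lra.
have normTx : enorm (aff_inv T x) = g^-1.
  rewrite Tinvx enorm2E !mxE /= expr0n add0r sqrrN sqrtr_sqr gtr0_norm//.
  by rewrite invr_gt0.
apply: (@le_trans _ _
  (Num.sqrt (1 - enorm (aff_inv T x)) * `|aff_det T|)%:E); last first.
  apply: ereal_sup_ubound; exists T => //; split.
    exists (aff_inv T x); last exact: aff_invK.
    by rewrite /unit_disk /= normTx invf_le1.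
  move=> _ [u u1 <-]; apply: contrapT => Dy.
  have [v] := separation x cvD cD (ex_intro _ x Dx') Dy.
  have {}u1 : u 0 0 ^+ 2 + u 1 0 ^+ 2 <= 1.
    move: u1; rewrite /unit_disk /= enorm2E -[X in _ <= X]sqrtr1.
    by rewrite ler_sqrt.
  (* With [t := dotv v (T u - x)], Cauchy-Schwarz on [t - s] yields
     [t (t - 2 s) <= Q v <= d (d - 2 s)], contradicting [d < t]. *)
  set w := wedge v v0; set s := dotv v c; set d := gap D x v.
  have -> : dotv v (T u - x) = s + (u 0 0 * (k * w) + u 1 0 * (g * s)).
    by rewrite /dotv ![(T u - x) _ _]mxE !TE !mxE /= /w /s /wedge /dotv; ring.
  set r := u 0 0 * _ + _ => dt.
  have r2 : r ^+ 2 <= (k * w) ^+ 2 + (g * s) ^+ 2.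
    apply: (@le_trans _ _
      ((u 0 0 ^+ 2 + u 1 0 ^+ 2) * ((k * w) ^+ 2 + (g * s) ^+ 2))).
      rewrite -subr_ge0 (_ : _ - _ = (u 0 0 * (g * s) - u 1 0 * (k * w)) ^+ 2).
        exact: sqr_ge0.
      by rewrite /r; ring.
    by rewrite ler_piMl// addr_ge0// sqr_ge0.
  have kw : (k * w) ^+ 2 <= gap2 D x v / 12.
    rewrite exprMn k2 mulrAC ler_pdivrMr; last by rewrite pmulr_rgt0.
    by rewrite (_ : _ / 12 * _ = gap2 D x v * P) ?mP//; field.
  have sgs : sg * s ^+ 2 <= gap2 D x v / 12.
    rewrite /sg mulrAC ler_pdivrMr; last by rewrite pmulr_rgt0.
    by rewrite (_ : _ / 12 * _ = 2 * gap2 D x v * s0 ^+ 2) ?v0P//; field.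
  have d0 : 0 <= d by exact: gap_ge0.
  have d'0 : 0 <= gap D x (- v) by exact: gap_ge0.
  have dP := cP v; rewrite -/d -/s in dP.
  have ds0 : 0 <= d - 2 * s by lra.
  have bd : gap2 D x v <= 6 * (d * (d - 2 * s)).
    by rewrite /gap2 -/d mulrCA ler_wpM2l.
  move: r2; rewrite [(g * s) ^+ 2]exprMn g2 mulrDl mul1r => r2.
  have : 0 < (s + r - d) * (s + r + (d - 2 * s)) by apply: mulr_gt0; lra.
  rewrite (_ : _ * _ = r ^+ 2 - s ^+ 2 - d * (d - 2 * s)); last by ring.
  move: (d * (d - 2 * s)) (s ^+ 2) (r ^+ 2) bd r2 kw sgs => *; lra.
rewrite lee_fin normTx /aff_det /= detA.
have -> : m / 24 = Num.sqrt ((m / 24) ^+ 2).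
  by rewrite sqrtr_sqr gtr0_norm// divr_gt0.
rewrite -sqrtr_sqr -sqrtrM ?subr_ge0 ?invf_le1//; apply: ler_wsqrtr.
(* What remains is [g ^+ 2 - g >= (g ^+ 2 - 1) / 2 = sg / 2], which is [(g - 1) ^+ 2 >= 0]. *)
have -> : (1 - g^-1) * (k * g * s0) ^+ 2 = (g ^+ 2 - g) * (k ^+ 2 * s0 ^+ 2).
  by field; rewrite gt_eqF.
have -> : (m / 24) ^+ 2 = sg / 2 * (k ^+ 2 * s0 ^+ 2).
  by rewrite k2 /sg; field; rewrite gt_eqF//= v0c.
apply: ler_wpM2r; first by apply: mulr_ge0; exact: sqr_ge0.
by have := sqr_ge0 (g - 1); lra.
Qed.

(** * Comparison of the two quantities, with constant 48 = 2 * 24 *)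

Theorem theorem2p1 (R : realType) :
  exists2 c : R, 0 < c &
    forall (D : set 'cV[R]_2) (x : 'cV[R]_2),
      planar_convex_body D -> D° x ->
      (U_inf x D <= c%:E * L_sup x D)%E.
Proof.
exists 48 => // D x [cvD cD _] Dx; have Dx' : D x by exact: interior_subset.
have U0 : (0 <= U_inf x D)%E.
  apply: le_ereal_inf_tmp => _ [T _ <-].
  by rewrite lee_fin mulr_ge0.
have [r rE] : exists r, U_inf x D = r%:E.
  have W1 : wedge (col2 1 0) (col2 0 1) != 0 :> R.
    by rewrite /wedge !mxE /= mulr1 mulr0 subr0 oner_eq0.
  have := U_inf_le cD Dx W1; case: (U_inf x D) U0 => //= r _ _.
  by exists r.
have r0 : 0 <= r by rewrite -lee_fin -rE.
have [e e0 eP] := gap2_ge_coord cD Dx.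
have P0 v : 0 <= gap2 D x v by exact: gap2_ge0.
(* [r / 2] is the value allowed by the parallelogram bound on [U_inf x D]; [e / 2] guarantees
   [0 < m] even if [r] is 0. *)
pose m : R := Num.max (r / 2) (e / 2).
have m0 : 0 < m by rewrite lt_max (divr_gt0 e0)// orbT.
have /(L_sup_ge cvD cD Dx m0) L : forall v w,
    m ^+ 2 * wedge v w ^+ 2 <= gap2 D x v * gap2 D x w.
  move=> v w; rewrite /m; case: (leP (r / 2) (e / 2)) => _.
    have h i j : e ^+ 2 * (v i 0 * w j 0) ^+ 2 <= gap2 D x v * gap2 D x w.
      rewrite (_ : _ * _ = (e * v i 0 ^+ 2) * (e * w j 0 ^+ 2)); last by ring.
      by apply: ler_pM; rewrite ?eP// mulr_ge0 ?sqr_ge0// ltW.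
    (* This square gives [(a - b)^2 <= 2 a^2 + 2 b^2] for the two products in the wedge; the
       resulting 4 is absorbed by the 2 in [e / 2]. *)
    have : 0 <= (e * (v 0 0 * w 1 0 + v 1 0 * w 0 0)) ^+ 2 by exact: sqr_ge0.
    have := h 0 1; have := h 1 0; rewrite /wedge; lra.
  have [->|W0] := eqVneq (wedge v w) 0; first by rewrite expr0n mulr0 mulr_ge0.
  have := U_inf_le cD Dx W0; rewrite rE lee_fin.
  rewrite ler_pdivlMr ?normr_gt0// => rW.
  rewrite -(@sqr_sqrtr _ (gap2 D x v * gap2 D x w)) ?(mulr_ge0 (P0 v) (P0 w))//.
  rewrite -[wedge v w ^+ 2]real_normK ?num_real// -exprMn.
  rewrite ler_pXn2r ?nnegrE//; last by rewrite mulr_ge0// divr_ge0.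
  lra.
have rm : r <= 48 * (m / 24).
  have : r / 2 <= m by rewrite le_max lexx.
  lra.
rewrite rE; apply: (@le_trans _ _ (48%:E * (m / 24)%:E)%E).
  by rewrite -EFinM lee_fin.
by rewrite lee_pmul2l.
Qed.
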